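(* Let $(R,+,\cdot)$ be an incline. Then $R$ is regular if and only if $R$ is a distributive lattice with respect to the incline operations, i.e. $(R,+,\cdot)$ is a distributive lattice with join $+$ and meet $\cdot$.
   Context: A semiring is a nonempty set $R$ with two operations $+$ and $\cdot$ such that $(R,+)$ is a commutative semigroup, $(R,\cdot)$ is a semigroup (not necessarily commutative), and multiplication distributes over addition from either side; no zero or identity element is assumed. An incline is a semiring $R$ that is additively idempotent ($a+a=a$ for all $a\in R$) and satisfies $x+xy=x+yx=x$ for all $x,y\in R$. On an incline a partial order is defined by $x\leqslant y \Leftrightarrow x+y=y$. An element $a$ of a semiring $R$ is regular if $axa=a$ for some $x\in R$; $R$ is regular if every element of $R$ is regular. A distributive lattice is not required to have a least or greatest element. *)

(* Defs.v *)
From mathcomp Require Import all_boot.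

Set Implicit Arguments.
Unset Strict Implicit.
Unset Printing Implicit Defensive.

(* Operations are explicit arguments and the laws are Prop records, since the
   library's semirings have a zero and a one, and its lattices
   (Order.distrLatticeType) have a choiceType carrier with a boolean order. *)

Record is_semiring (R : Type) (add mul : R -> R -> R) : Prop := IsSemiring {
  semiring_inhabited : inhabited R;
  semiring_addA : associative add;
  semiring_addC : commutative add;
  semiring_mulA : associative mul;
  semiring_mulDl : left_distributive mul add;
  semiring_mulDr : right_distributive mul add
}.

Record is_incline (R : Type) (add mul : R -> R -> R) : Prop := IsIncline {
  incline_semiring : is_semiring add mul;
  incline_addxx : idempotent_op add;
  incline_addKMr : forall x y : R, add x (mul x y) = x;
  incline_addKMl : forall x y : R, add x (mul y x) = x
}.

Definition regular_elt (R : Type) (mul : R -> R -> R) (a : R) : Prop :=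
  exists x : R, mul (mul a x) a = a.

Definition is_regular (R : Type) (mul : R -> R -> R) : Prop :=
  forall a : R, regular_elt mul a.

Record is_distr_lattice (L : Type) (join meet : L -> L -> L) : Prop :=
  IsDistrLattice {
  lattice_inhabited : inhabited L;
  lattice_joinA : associative join;
  lattice_joinC : commutative join;
  lattice_joinxx : idempotent_op join;
  lattice_meetA : associative meet;
  lattice_meetC : commutative meet;
  lattice_meetxx : idempotent_op meet;
  lattice_meetKU : forall x y : L, join x (meet x y) = x;
  lattice_joinKI : forall x y : L, meet x (join x y) = x;
  lattice_meetUr : right_distributive meet join
}.

(* Main.v *)
Require Import Defs.
From mathcomp Require Import all_boot.

(** Regularity forces idempotence: since [a x <= a], [a = a x a <= a a <= a].
    Commutativity follows, as [a b = (a b)(a b) = a (b a) b <= b a]. *)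

(** Once the product is idempotent and commutative, an incline satisfies every distributive lattice
    law: the remaining absorption law follows from distributivity. Conversely, an idempotent product
    gives [a a a = a]. *)

Lemma incline_regular_mulxx (R : Type) (add mul : R -> R -> R) (a : R) :
  is_incline add mul -> regular_elt mul a -> mul a a = a.
Proof.
case=> [[_ _ addC _ mulDl _] _ addKMr _] [x axa].
by rewrite -{1}[a in mul a _](addKMr a x) mulDl axa addC addKMr.
Qed.

(** Chains [y x z <= y x <= x]. *)
Lemma incline_addKMlr (R : Type) (add mul : R -> R -> R) (x y z : R) :
  is_incline add mul -> add x (mul (mul y x) z) = x.
Proof.
case=> [[_ addA _ _ _ _] _ addKMr addKMl].
by rewrite -{1}(addKMl x y) -addA addKMr addKMl.
Qed.

Lemma incline_idem_mulC (R : Type) (add mul : R -> R -> R) :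
  is_incline add mul -> idempotent_op mul -> commutative mul.
Proof.
move=> hR mulxx; have [[_ _ addC mulA _ _] _ _ _] := hR.
have le_swap a b : add (mul b a) (mul a b) = mul b a.
  by rewrite -(mulxx (mul a b)) mulA -(mulA a b a) incline_addKMlr.
(* Antisymmetry: [a b] and [b a] both equal their sum. *)
by move=> a b; rewrite -[RHS]le_swap addC le_swap.
Qed.

Theorem theorem3p5 (R : Type) (add mul : R -> R -> R) (hR : is_incline add mul) :
  is_regular mul <-> is_distr_lattice add mul.
Proof.
split=> [reg | [_ _ _ _ _ _ mulxx _ _ _] a]; last by exists a; rewrite !mulxx.
have mulxx : idempotent_op mul.
  by move=> a; apply: incline_regular_mulxx hR (reg a).
have mulC := incline_idem_mulC _ _ _ hR mulxx.
have [[inhR addA addC mulA _ mulDr] addxx addKMr _] := hR.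
(* Only [lattice_joinKI] needs work: [x (x + y) = x x + x y = x + x y = x]. *)
by split=> // x y; rewrite mulDr mulxx addKMr.
Qed.
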